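(* Let $K$ be a metric space, let $W\subset K$ be non-empty, and let $f\in D(W)$ be given. (a) There exists a $g\in D(K)$ with $g|W=f$. Moreover, (i) if $f$ is real-valued, $g$ may be chosen (real-valued) with $\|g\|_{D(K)}=\|f\|_{D(W)}$; (ii) if $W$ is a DCS and $\varepsilon>0$ is given, then $g$ may be chosen with $\|g\|_{D(K)}\le\|f\|_{D(W)}+\varepsilon$. (b) If $W$ is a DCS, then $\|f\chi_W\|_{D(K)}\le2\|f\|_{D(W)}$, while if $W$ is open, then $\|f\chi_W\|_{D(K)}=\|f\|_{D(W)}$.
   Context: For a metric space $X$ (in particular for a subset $W$ of $K$ with the induced metric), $D(X)$ is the set of all $f:X\to\mathbb{C}$ of the form $f=(\varphi_1-\varphi_2)+i(\varphi_3-\varphi_4)$ with $\varphi_1,\dots,\varphi_4$ bounded real-valued lower semi-continuous functions on $X$. Equivalently, $f\in D(X)$ iff there is a sequence $(\varphi_j)$ of continuous complex-valued functions on $X$ with $\sup_{x\in X}\sum_j|\varphi_j(x)|<\infty$ and $f=\sum_j\varphi_j$ pointwise; $\|f\|_{D(X)}$ is the infimum of $\sup_{x\in X}\sum_j|\varphi_j(x)|$ over all such sequences (and $\infty$ if $f\notin D(X)$). For $f:W\to\mathbb{C}$, $f\chi_W$ denotes the function on $K$ that equals $f$ on $W$ and $0$ off $W$. $W$ is a DCS (difference of closed sets) if $W=A_1\setminus A_2$ for some closed subsets $A_1,A_2$ of $K$. *)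

(* Defs.v *)
From HB Require Import structures.
From mathcomp Require Import all_boot all_order all_algebra.
From mathcomp Require Import all_classical all_reals all_analysis.
From mathcomp Require Export complex.

Set Implicit Arguments.
Unset Strict Implicit.
Unset Printing Implicit Defensive.

Import Order.TTheory GRing.Theory Num.Theory.
Import numFieldNormedType.Exports.

Local Open Scope classical_set_scope.
Local Open Scope ring_scope.

(* The library makes the subtype of a set in a (pseudo)metric space a
   pseudometric space; for a metric space it carries the induced metric. *)
Section set_type_metric.
Context {R : realType} {K : metricType R} (W : set K).

Let dist (x y : W) : R := mdist (set_val x) (set_val y).

Let dist_ge0 x y : 0 <= dist x y.
Proof. exact: mdist_ge0. Qed.

Let dist_positivity x y : dist x y = 0 -> x = y.
Proof. by move=> /mdist_positivity /val_inj. Qed.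

Let ballEdist x d : ball x d = [set y | dist x y < d].
Proof. by rewrite -initial_ballE ballEmdist. Qed.

HB.instance Definition _ := @PseudoMetric_isMetric.Build R (set_type W)
  dist dist_ge0 dist_positivity ballEdist.

End set_type_metric.

Section D_space.
Context {R : realType} {X : metricType R}.

Definition bounded_lsc (phi : X -> R) : Prop :=
  bounded_fun phi /\ lower_semicontinuous (EFin \o phi).

Definition D_space : set (X -> R[i]) :=
  [set f | exists phi1 phi2 phi3 phi4 : X -> R,
    [/\ bounded_lsc phi1, bounded_lsc phi2, bounded_lsc phi3, bounded_lsc phi4
      & forall x, f x = Complex (phi1 x - phi2 x) (phi3 x - phi4 x)]].

(* [`|z|] has type R[i]; its real part is the usual modulus in R. *)
Definition sup_abs_sum (phi : nat -> X -> R[i]) : \bar R :=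
  ereal_sup [set (\sum_(0 <= j <oo) (complex.Re `|phi j x|)%:E)%E
            | x in [set: X]].

(* Topologies on the field R[i] are attached to its regular module (R[i])^o. *)
Definition D_representation (f : X -> R[i]) (phi : nat -> X -> R[i]) : Prop :=
  [/\ forall j, continuous (phi j : X -> (R[i])^o),
      (sup_abs_sum phi < +oo)%E
    & forall x, (series (fun j => phi j x) : nat -> (R[i])^o) @ \oo
                --> (f x : (R[i])^o)].

(* The infimum is +oo when there is no representation, i.e. when f is not in
   D(X). *)
Definition D_norm (f : X -> R[i]) : \bar R :=
  ereal_inf [set sup_abs_sum phi | phi in D_representation f].

End D_space.

Definition is_DCS {T : topologicalType} (W : set T) : Prop :=
  exists A1 A2 : set T, [/\ closed A1, closed A2 & W = A1 `\` A2].

Definition real_valued {R : realType} {T : Type} (f : T -> R[i]) : Prop :=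
  forall x, f x \is Num.real.

(* Main.v *)
(** Real case: a sum [f = \sum_j phi_j] with [\sum_j |phi_j| <= r] splits into
    positive and negative parts, [f = u - v] with [u, v >= 0] l.s.c. and
    [u + v <= r]; taking suprema over [r + 1/n] shows that the infimum is
    attained.  On all of K,
      [p_n x = inf_(y in W) (u y + n d(x, y)) - n d(x, W)]
    is continuous, nondecreasing in n and tends to u on W; if [q_n] is built
    likewise from v then [p_n + q_n <= r], and the limit of [p_n - q_n] is the
    required extension.

    Indicator of an open set U: take continuous cutoffs [theta_n] increasing to
    the indicator of U, and replace the partial sums [P_n] by [theta_n P_n].
    The variation telescopes to at most [theta_n \sum_(j < n) |phi_j|], so the
    bound is preserved.

    Closed set: extend each term by Tietze, then cut off the terms at the points
    where the sum of the moduli so far exceeds r by more than eps.  A DCS is open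
    in a closed set, which gives (ii), and [f chi_W = g - g chi_(~` A1)] for the
    extension g obtained from W = A1 \ A2 gives the factor 2 in (b). *)

Require Import Defs.
From mathcomp Require Import all_boot all_order all_algebra.
From mathcomp Require Import all_classical all_reals all_analysis.
From mathcomp Require Import lra ring.

Set Implicit Arguments.
Unset Strict Implicit.
Unset Printing Implicit Defensive.

Import Order.TTheory GRing.Theory Num.Theory.
Import numFieldNormedType.Exports.
Import ComplexField.Normc.

Local Open Scope classical_set_scope.
Local Open Scope ring_scope.

(** * Real part, imaginary part and modulus of complex numbers *)

Lemma ReD (R : rcfType) (x y : R[i]) :
  complex.Re (x + y) = complex.Re x + complex.Re y.
Proof. by case: x y => ? ? []. Qed.

Lemma ReB (R : rcfType) (x y : R[i]) :
  complex.Re (x - y) = complex.Re x - complex.Re y.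
Proof. by case: x y => ? ? []. Qed.

Lemma ImD (R : rcfType) (x y : R[i]) :
  complex.Im (x + y) = complex.Im x + complex.Im y.
Proof. by case: x y => ? ? []. Qed.

Lemma ImB (R : rcfType) (x y : R[i]) :
  complex.Im (x - y) = complex.Im x - complex.Im y.
Proof. by case: x y => ? ? []. Qed.

Lemma normc_ge0 (R : rcfType) (z : R[i]) : 0 <= normc z.
Proof. by case: z => a b; rewrite sqrtr_ge0. Qed.

Lemma normc_real (R : rcfType) (a : R) : normc a%:C%C = `|a|.
Proof. by rewrite /= expr0n addr0 sqrtr_sqr. Qed.

Lemma le_Re_normc (R : rcfType) (z : R[i]) : `|complex.Re z| <= normc z.
Proof. by rewrite -lecR; exact: normc_ge_Re. Qed.

Lemma le_Im_normc (R : rcfType) (z : R[i]) : `|complex.Im z| <= normc z.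
Proof. by case: z => a b; rewrite -sqrtr_sqr ler_wsqrtr// lerDr sqr_ge0. Qed.

Lemma normc_le_ReIm (R : rcfType) (z : R[i]) :
  normc z <= `|complex.Re z| + `|complex.Im z|.
Proof.
have -> : z = (complex.Re z)%:C%C + 'i%C * (complex.Im z)%:C%C by exact: complexE.
apply: (le_trans (le_normcD _ _)); rewrite normcM !normc_real.
rewrite (_ : normc 'i%C = 1) ?mul1r; last first.
  by rewrite /= expr0n/= expr1n add0r sqrtr1.
by case: z => a b /=; rewrite !(mul0r, mul1r, mulr0, subr0, addr0, add0r).
Qed.

(** * Convergence and continuity of complex-valued functions *)

Section complex_topology.
Context {R : realType}.

(** A positive element of [R[i]] has zero imaginary part, so real radii suffice. *)
Lemma cvgcP {T} {F : set_system T} {FF : Filter F} (f : T -> R[i]) (l : R[i]) :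
  ((f : T -> (R[i])^o) @ F --> (l : (R[i])^o)) <->
  (forall e : R, 0 < e -> \forall t \near F, normc (l - f t) < e).
Proof.
split=> [/cvgrPdist_lt H e e0|H].
  have := H e%:C%C; rewrite ltcR => /(_ e0); apply: filterS => t.
  by rewrite ltcR.
apply/cvgrPdist_lt => e; rewrite ltcE => /andP[/eqP Ime e0].
have := H _ e0; apply: filterS => t lt.
by rewrite ltcE Ime eqxx.
Qed.

Lemma cvg_ReIm {T} {F : set_system T} {FF : Filter F} (f : T -> R[i])
    (l : R[i]) :
  ((f : T -> (R[i])^o) @ F --> (l : (R[i])^o)) <->
  (complex.Re (f t) @[t --> F] --> complex.Re l) /\
  (complex.Im (f t) @[t --> F] --> complex.Im l).
Proof.
rewrite cvgcP; split=> [H|[/cvgrPdist_lt Hr /cvgrPdist_lt Hi] e e0].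
  split; apply/cvgrPdist_lt => e /H; apply: filterS => t; apply: le_lt_trans.
    by rewrite -ReB le_Re_normc.
  by rewrite -ImB le_Im_normc.
have e2 : 0 < e / 2 by rewrite divr_gt0.
near=> t; apply: (le_lt_trans (normc_le_ReIm _)).
rewrite (splitr e) ReB ImB ltrD//; near: t; [exact: Hr|exact: Hi].
Unshelve. all: by end_near. Qed.

Lemma continuous_ReIm {T : topologicalType} (f : T -> R[i]) :
  continuous (f : T -> (R[i])^o) <->
  continuous (fun t => complex.Re (f t)) /\
  continuous (fun t => complex.Im (f t)).
Proof.
split=> [cf|[cr ci] x]; last by apply/cvg_ReIm; split; [exact: cr|exact: ci].
by split=> x; have /cvg_ReIm[] := cf x.
Qed.

Lemma cvg_normc {T} {F : set_system T} {FF : Filter F} (f : T -> R[i])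
    (l : R[i]) :
  ((f : T -> (R[i])^o) @ F --> (l : (R[i])^o)) ->
  normc (f t) @[t --> F] --> normc l.
Proof.
move=> /cvgcP H; apply/cvgrPdist_lt => e /H; apply: filterS => t; apply: le_lt_trans.
(* The reverse triangle inequality in [Rcomplex R], where the norm is [normc] with values in [R]. *)
exact: (@ler_dist_dist _ (Rcomplex R) l (f t)).
Qed.

End complex_topology.

Lemma cvg_sum_nat {K : numFieldType} {V : normedModType K} {T : Type}
    {F : set_system T} {FF : Filter F} (f : nat -> T -> V) (l : nat -> V)
    (n : nat) :
  (forall j, f j @ F --> l j) ->
  \sum_(0 <= j < n) f j t @[t --> F] --> \sum_(0 <= j < n) l j.
Proof.
move=> fl; elim: n => [|n IH].
  by rewrite big_geq//; under eq_fun do rewrite big_geq//; exact: cvg_cst.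
rewrite big_nat_recr//=; under eq_fun do rewrite big_nat_recr//=.
by apply: cvgD; [exact: IH|exact: fl].
Qed.

Section complex_limits.
Context {R : realType} {T : Type} {F : set_system T} {FF : Filter F}.
Implicit Types (f g : T -> R[i]) (a b : R[i]).

Lemma cvgcD f g a b :
  ((f : T -> (R[i])^o) @ F --> (a : (R[i])^o)) ->
  ((g : T -> (R[i])^o) @ F --> (b : (R[i])^o)) ->
  ((fun t => f t + g t) : T -> (R[i])^o) @ F --> (a + b : (R[i])^o).
Proof. exact: (@cvgD _ (R[i])^o). Qed.

Lemma cvgcB f g a b :
  ((f : T -> (R[i])^o) @ F --> (a : (R[i])^o)) ->
  ((g : T -> (R[i])^o) @ F --> (b : (R[i])^o)) ->
  ((fun t => f t - g t) : T -> (R[i])^o) @ F --> (a - b : (R[i])^o).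
Proof. exact: (@cvgB _ (R[i])^o). Qed.

Lemma cvgcM f g a b :
  ((f : T -> (R[i])^o) @ F --> (a : (R[i])^o)) ->
  ((g : T -> (R[i])^o) @ F --> (b : (R[i])^o)) ->
  ((fun t => f t * g t) : T -> (R[i])^o) @ F --> (a * b : (R[i])^o).
Proof. exact: (@cvgM R[i] T F FF f g a b). Qed.

Lemma cvg_real_complex (h : T -> R) (l : R) : h @ F --> l ->
  ((fun t => (h t)%:C%C) : T -> (R[i])^o) @ F --> (l%:C%C : (R[i])^o).
Proof. by move=> hl; apply/cvg_ReIm; split=> //=; exact: cvg_cst. Qed.

End complex_limits.

(** * The subtype of a set and the subspace topology *)

Section set_type_topology.
Context {R : realType} {K : metricType R} (W : set K).

(** In the induced metric a ball of [W] is the trace of the ball of [K] with the same radius. *)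
Lemma near_set_val (w : W) (P : set K) :
  (\forall y \near within W (nbhs (set_val w)), P y) <->
  (\forall v \near w, P (set_val v)).
Proof.
rewrite near_withinE; split => /nbhs_ballP[e e0 H]; apply/nbhs_ballP; exists e => //.
  by move=> v; rewrite ballEmdist /= => vw; apply: H; [rewrite ballEmdist|exact: set_valP].
move=> y; rewrite ballEmdist /= => yw Wy.
by have := H (SigSub (mem_set Wy)); rewrite ballEmdist; apply.
Qed.

Lemma valL_set_val {T : Type} (t : T) (f : W -> T) (w : W) :
  valL_ t f (set_val w) = f w.
Proof. by rewrite -[LHS]/(sigL W (valL_ t f) w) valLK. Qed.

Lemma within_continuous_set_val {S : topologicalType} (f : K -> S) :
  {within W, continuous f} <-> continuous (f \o set_val : W -> S).
Proof.
rewrite subspace_continuousP; split=> cf x.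
  by move=> U /(cf _ (set_valP x)) /near_set_val.
by move=> Wx U fU; apply/(near_set_val (SigSub (mem_set Wx)))/cf.
Qed.

End set_type_topology.

(** * Representations on a subset, and the norm of D(X) *)

Section representations.
Context {R : realType} {K : metricType R}.
Implicit Types (A : set K) (f : K -> R[i]) (r : R).

(* The representations of [f] of total variation at most [r] that only live on
   [A]; values of [f] and [phi] off [A] are irrelevant. *)
Definition summation_on A f r := exists phi : nat -> K -> R[i],
  [/\ forall j, {within A, continuous (phi j : K -> (R[i])^o)},
      forall x, A x -> forall n, \sum_(0 <= j < n) normc (phi j x) <= r
    & forall x, A x -> (series (fun j => phi j x) : nat -> (R[i])^o) @ \oo
                       --> (f x : (R[i])^o)].

End representations.

Section D_norm_lemmas.
Context {R : realType} {X : metricType R}.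
Implicit Types (f : X -> R[i]) (r : R).

Lemma sup_abs_sum_le (phi : nat -> X -> R[i]) r :
  (forall x n, \sum_(0 <= j < n) normc (phi j x) <= r) <->
  (sup_abs_sum phi <= r%:E)%E.
Proof.
have phi0 x j : (0 <= (normc (phi j x))%:E)%E by rewrite lee_fin normc_ge0.
split=> [H|H x n].
  apply: ge_ereal_sup => _ [x _ <-]; apply: lime_le.
    by apply: is_cvg_nneseries => n _ _; exact: phi0.
  by apply: nearW => n; rewrite sumEFin lee_fin; exact: H.
rewrite -lee_fin; apply: le_trans H.
apply: (@le_trans _ _ (\sum_(0 <= j <oo) (normc (phi j x))%:E)%E).
  by rewrite -sumEFin; apply: nneseries_lim_ge => k _ _; exact: phi0.
by apply: ereal_sup_ubound; exists x.
Qed.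

Lemma summation_on_setT_P f r :
  summation_on [set: X] f r <->
  exists phi, D_representation f phi /\ (sup_abs_sum phi <= r%:E)%E.
Proof.
split=> [[phi [c s l]]|[phi [[c s l] sr]]]; exists phi.
  have sr : (sup_abs_sum phi <= r%:E)%E.
    by apply/sup_abs_sum_le => x n; exact: s.
  split=> //; split=> [j||x]; [|exact: le_lt_trans sr (ltry _)|exact: l].
  by apply/continuous_subspace_setT.
split=> [j|x _ n|x _]; [|by move/sup_abs_sum_le : sr; apply|exact: l].
by apply: continuous_subspaceT; exact: c.
Qed.

Lemma D_norm_le f r : summation_on [set: X] f r -> (D_norm f <= r%:E)%E.
Proof.
move=> /summation_on_setT_P[phi [rep sr]].
by apply: le_trans sr; apply: ereal_inf_lbound; exists phi.
Qed.

(** The inequality is strict because the infimum is not assumed to be attained; the error terms in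
    later bounds come from here. *)
Lemma D_norm_lt f r : (D_norm f < r%:E)%E -> summation_on [set: X] f r.
Proof.
move=> /ereal_inf_lt[_ [phi rep <-] /ltW sr].
by apply/summation_on_setT_P; exists phi.
Qed.

(** The point matters: on an empty space [sup_abs_sum] is the supremum of the empty set, [-oo]. *)
Lemma D_norm_ge0 f : X -> (0 <= D_norm f)%E.
Proof.
move=> x; apply: le_ereal_inf_tmp => _ [phi _ <-].
apply: (@le_trans _ _ (\sum_(0 <= j <oo) (normc (phi j x))%:E)%E).
  by apply: nneseries_ge0 => j _ _; rewrite lee_fin normc_ge0.
by apply: ereal_sup_ubound; exists x.
Qed.

End D_norm_lemmas.

(** Lets the later constructions take place on [K], relative to subsets, without nested subtypes. *)
Lemma summation_on_set_type {R : realType} {K : metricType R} (W : set K)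
    (f : K -> R[i]) (r : R) :
  summation_on [set: W] (sigL W f) r <-> summation_on W f r.
Proof.
split=> [[phi [c s l]]|[phi [c s l]]].
  exists (fun j => valL_ 0 (phi j)); split=> [j|x Wx n|x Wx].
  - apply/within_continuous_set_val.
    rewrite (_ : _ \o _ = phi j); first exact/continuous_subspace_setT.
    by apply/funext => w; exact: valL_set_val.
  - set w : W := SigSub (mem_set Wx).
    rewrite -[x]/(set_val w).
    under eq_bigr do rewrite valL_set_val.
    exact: s.
  - set w : W := SigSub (mem_set Wx).
    rewrite -[x]/(set_val w).
    under eq_fun do rewrite valL_set_val.
    exact: l.
exists (fun j => phi j \o set_val); split=> [j|x _ n|x _].
- by apply: continuous_subspaceT; apply/within_continuous_set_val.
- by apply: s; exact: set_valP.
- by apply: l; exact: set_valP.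
Qed.

(** * Differences of lower semicontinuous functions *)

Section lower_semicontinuity.
Context {R : realType} {K : metricType R}.
Implicit Types (A : set K) (u v g : K -> R) (f : K -> R[i]) (r : R).

Definition lsc_on A u := forall x, A x -> forall a, a < u x ->
  \forall y \near within A (nbhs x), a < u y.

Lemma continuous_lsc_on A u : {within A, continuous u} -> lsc_on A u.
Proof.
move=> /subspace_continuousP cu x Ax a aux.
exact: (cvgr_gt _ (cu x Ax)).
Qed.

Lemma lsc_onDr A u c : lsc_on A u -> lsc_on A (fun x => u x + c).
Proof.
move=> lu x Ax a; rewrite -ltrBlDr => /(lu x Ax).
by apply: filterS => y; rewrite ltrBlDr.
Qed.

Lemma lsc_on_sup A (u_ : nat -> K -> R) u :
  (forall n, lsc_on A (u_ n)) ->
  (forall x, A x -> forall n, u_ n x <= u x) ->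
  (forall x, A x -> forall a, a < u x -> exists n, a < u_ n x) ->
  lsc_on A u.
Proof.
move=> lu ule ulim x Ax a /(ulim x Ax)[n /(lu n x Ax)].
rewrite !near_withinE; apply: filterS => y + Ay => /(_ Ay) /lt_le_trans; apply.
exact: ule.
Qed.

(** Real counterpart of [summation_on]: [u] and [v] play the sums of the positive and of the
    negative parts of the terms, so [u + v] plays the total variation. *)
Definition lsc_difference_on A g r := exists u v : K -> R,
  [/\ lsc_on A u, lsc_on A v & forall x, A x ->
      [/\ 0 <= u x, 0 <= v x, u x + v x <= r & g x = u x - v x]].

(** The positive parts of the terms sum to [u], the negative parts to [v]. Both are suprema of
    continuous partial sums, hence l.s.c., and [u + v] is the sum of the [|a j|]. *)
Lemma series_lsc_difference A (a : nat -> K -> R) g r :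
  (forall j, {within A, continuous (a j)}) ->
  (forall x, A x -> forall n, \sum_(0 <= j < n) `|a j x| <= r) ->
  (forall x, A x -> series (fun j => a j x) @ \oo --> g x) ->
  lsc_difference_on A g r.
Proof.
move=> ca ar ag.
have part_lsc (b : nat -> K -> R) : (forall j, {within A, continuous (b j)}) ->
    (forall j x, 0 <= b j x <= `|a j x|) ->
    exists u, [/\ lsc_on A u, forall x, A x -> 0 <= u x
      & forall x, A x -> series (fun j => b j x) @ \oo --> u x].
  move=> cb ba.
  have bnd x : nondecreasing_seq (series (fun j => b j x)).
    by apply/nondecreasing_seqP => n; rewrite /series/= big_nat_recr//= lerDl;
      have /andP[] := ba n x.
  have bub x : A x -> has_ubound (range (series (fun j => b j x))).
    move=> Ax; exists r => _ [n _ <-]; apply: le_trans (ar x Ax n).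
    by apply: ler_sum => j _; have /andP[] := ba j x.
  pose u x := sup (range (series (fun j => b j x))).
  have ule x n : A x -> series (fun j => b j x) n <= u x.
    by move=> Ax; apply: ub_le_sup; [exact: bub|exists n].
  exists u; split.
  - apply: (@lsc_on_sup _ (fun n x => series (fun j => b j x) n)).
    + move=> n; apply: continuous_lsc_on => x.
      by apply: cvg_sum_nat => j; exact: cb.
    + by move=> x Ax n; exact: ule.
    + move=> x Ax c /sup_gt[|_ [n _ <-] cn]; last by exists n.
      by exists (series (fun j => b j x) 0%N), 0%N.
  - by move=> x Ax; apply: le_trans (ule x 0%N Ax); rewrite /series/= big_geq.
  - by move=> x Ax; apply: nondecreasing_cvgn; [exact: bnd|exact: bub].
have ap (x : R) : 0 <= Num.max x 0 <= `|x|.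
  by rewrite le_max lexx orbT ge_max ler_norm normr_ge0.
have apm (x : R) : x = Num.max x 0 - Num.max (- x) 0 /\
    Num.max x 0 + Num.max (- x) 0 = `|x|.
  have [x0|/ltW x0] := leP 0 x.
    by rewrite ger0_norm// max_r ?oppr_le0// subr0 addr0.
  by rewrite ler0_norm// max_l ?oppr_ge0// sub0r add0r opprK.
have cmax (b : nat -> K -> R) : (forall j, {within A, continuous (b j)}) ->
    forall j, {within A, continuous (fun x => Num.max (b j x) 0)}.
  move=> cb j x; apply: (@continuous_max R (subspace A) (b j) (fun=> 0)).
    exact: cb.
  exact: cvg_cst.
have [u [lu u0 su]] := part_lsc (fun j x => Num.max (a j x) 0) (cmax a ca)
  (fun j x => ap (a j x)).
have cNa j : {within A, continuous (fun x => - a j x)}.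
  by move=> x; apply: cvgN; exact: ca.
have apN j x : 0 <= Num.max (- a j x) 0 <= `|a j x| by rewrite -normrN.
have [v [lv v0 sv]] := part_lsc (fun j x => Num.max (- a j x) 0) (cmax _ cNa)
  apN.
exists u, v; split=> // x Ax; split; [exact: u0|exact: v0| |].
- apply: (@cvgr_to_le _ _ _ _ _ _ _ (cvgD (su x Ax) (sv x Ax))).
  apply: nearW => n /=; rewrite fctE /series/= -big_split/=.
  apply: le_trans (ar x Ax n); apply: ler_sum => j _.
  by have [] := apm (a j x) => _ ->.
- apply: (cvg_unique (@Rhausdorff R) (ag x Ax)).
  rewrite (_ : series _ = series (fun j => Num.max (a j x) 0) -
                          series (fun j => Num.max (- a j x) 0)).
    by apply: cvgB; [exact: su|exact: sv].
  apply/funext => n; rewrite fctE /series/= -sumrB; apply: eq_bigr => j _.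
  by have [] := apm (a j x).
Qed.

Lemma summation_lsc_difference A f r : summation_on A f r ->
  lsc_difference_on A (fun x => complex.Re (f x)) r /\
  lsc_difference_on A (fun x => complex.Im (f x)) r.
Proof.
move=> [phi [c s l]].
have Re_series x n : complex.Re (series (fun j => phi j x) n) =
    series (fun j => complex.Re (phi j x)) n.
  by rewrite /series/=; apply: (big_morph _ (@ReD R) (erefl _)).
have Im_series x n : complex.Im (series (fun j => phi j x) n) =
    series (fun j => complex.Im (phi j x)) n.
  by rewrite /series/=; apply: (big_morph _ (@ImD R) (erefl _)).
split.
- apply: (@series_lsc_difference _ (fun j x => complex.Re (phi j x))).
  + by move=> j; have /continuous_ReIm[] := c j.
  + move=> x Ax n; apply: le_trans (s x Ax n).
    by apply: ler_sum => j _; exact: le_Re_normc.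
  + move=> x Ax; have /cvg_ReIm[+ _] := l x Ax.
    by apply: cvg_trans; apply: near_eq_cvg; exact: nearW.
- apply: (@series_lsc_difference _ (fun j x => complex.Im (phi j x))).
  + by move=> j; have /continuous_ReIm[] := c j.
  + move=> x Ax n; apply: le_trans (s x Ax n).
    by apply: ler_sum => j _; exact: le_Im_normc.
  + move=> x Ax; have /cvg_ReIm[_] := l x Ax.
    by apply: cvg_trans; apply: near_eq_cvg; exact: nearW.
Qed.

(** Given [u_n - v_n = g] and [u_n + v_n <= r + e n], the suprema over n of [u_n - e n / 2] and
    [v_n - e n / 2] are l.s.c. and form a decomposition with bound [r]. *)
Lemma lsc_difference_attained A g r :
  (forall e, 0 < e -> lsc_difference_on A g (r + e)) -> lsc_difference_on A g r.
Proof.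
move=> H.
pose e n : R := n.+1%:R^-1.
have e0 n : 0 < e n by rewrite invr_gt0.
have /choice[uv Huv] : forall n, exists uv : (K -> R) * (K -> R),
   [/\ lsc_on A uv.1, lsc_on A uv.2 & forall x, A x ->
      [/\ 0 <= uv.1 x, 0 <= uv.2 x, uv.1 x + uv.2 x <= r + e n
        & g x = uv.1 x - uv.2 x]].
  by move=> n; have [u [v uvP]] := H _ (e0 n); exists (u, v).
(* The boolean treats both components at once: [true] for [u_n], [false] for [v_n]. *)
pose w (k : bool) n := if k then (uv n).1 else (uv n).2.
have w0 k x n : A x -> 0 <= w k n x.
  by move=> Ax; have [_ _ /(_ x Ax)[]] := Huv n; case: k.
(* Half the sum of the bound on [u_n + v_n] and the identity for [u_n - v_n]; the shift by [e n / 2]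
   makes the bound independent of n. *)
have wr k x n : A x -> w k n x - e n / 2 <=
    (r + (if k then g x else - g x)) / 2.
  by move=> Ax; have [_ _ /(_ x Ax)[]] := Huv n; rewrite /w; case: k; lra.
pose s k x := sup (range (fun n => w k n x - e n / 2)).
have wub k x : A x -> has_ubound (range (fun n => w k n x - e n / 2)).
  by move=> Ax; exists ((r + (if k then g x else - g x)) / 2) => _ [n _ <-];
    exact: wr.
have wsup k x : range (fun n => w k n x - e n / 2) !=set0.
  by exists (w k 0%N x - e 0%N / 2), 0%N.
have ws k x n : A x -> w k n x - e n / 2 <= s k x.
  by move=> Ax; apply: ub_le_sup; [exact: wub|exists n].
have ls k : lsc_on A (s k).
  apply: (@lsc_on_sup _ (fun n x => w k n x - e n / 2)).
  - by move=> n; apply: lsc_onDr; have [] := Huv n; case: k.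
  - by move=> x Ax n; exact: ws.
  - by move=> x Ax c /(sup_gt (wsup k x))[_ [n _ <-] cn]; exists n.
have s0 k x : A x -> 0 <= s k x.
  move=> Ax; apply/ler_addgt0Pr => d d0.
  have [n nd] : exists n, e n < d.
    have [n _ /(_ n (leqnn n))] := near_infty_natSinv_lt (PosNum d0).
    by exists n.
  have := ws k x n Ax; have := w0 k x n Ax; lra.
have sle k x : A x -> s k x <= (r + (if k then g x else - g x)) / 2.
  by move=> Ax; apply: ge_sup; [exact: wsup|move=> _ [n _ <-]; exact: wr].
(* Both sequences carry the same shift and differ by [g x] for every n, so their suprema differ by
   [g x]. *)
have sg x : A x -> s true x = s false x + g x.
  move=> Ax; apply/eqP; rewrite eq_le; apply/andP; split.
    apply: ge_sup; first exact: wsup.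
    move=> _ [n _ <-]; have := ws false x n Ax.
    by have [_ _ /(_ x Ax)[]] := Huv n; rewrite /w; lra.
  rewrite -lerBrDr; apply: ge_sup; first exact: wsup.
  move=> _ [n _ <-]; have := ws true x n Ax.
  by have [_ _ /(_ x Ax)[]] := Huv n; rewrite /w; lra.
exists (s true), (s false); split=> // x Ax; split; [exact: s0|exact: s0| |].
  by have := sle true x Ax; have := sg x Ax; lra.
by have := sg x Ax; lra.
Qed.

End lower_semicontinuity.

Lemma lsc_difference_bounded_lsc {R : realType} {X : metricType R} (g : X -> R)
    (r : R) : lsc_difference_on [set: X] g r ->
  exists u v : X -> R, [/\ bounded_lsc u, bounded_lsc v
    & forall x, g x = u x - v x].
Proof.
move=> [u [v [lu lv uv]]].
have bl (w : X -> R) : lsc_on [set: X] w -> (forall x, 0 <= w x <= r) ->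
    bounded_lsc w.
  move=> lw wr; split.
    exists r; split=> [|M /ltW rM x _ /=]; first exact: num_real.
    by have /andP[w0 wxr] := wr x; rewrite ger0_norm// (le_trans wxr).
  move=> x a; rewrite lte_fin => /(lw x I); rewrite near_withinE => nw.
  by exists [set y | a < w y] => //; move: nw; apply: filterS => y; exact.
exists u, v; split.
- by apply: bl => // x; have [] := uv x I; lra.
- by apply: bl => // x; have [] := uv x I; lra.
- by move=> x; have [] := uv x I.
Qed.

Lemma bounded_lsc_on {R : realType} {K : metricType R} (W : set K)
    (phi : W -> R) : bounded_lsc phi ->
  lsc_on W (valL_ 0 phi) /\ exists M, forall w, `|phi w| <= M.
Proof.
move=> [[M [_ bM]] lphi]; split; last first.
  (* Boundedness is stated for the numbers strictly above [M], hence [M + 1]. *)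
  by exists (M + 1) => w; apply: bM; rewrite ?ltrDl.
move=> x Wx a; set w : W := SigSub (mem_set Wx).
rewrite -[x]/(set_val w) valL_set_val => aphi.
apply/near_set_val; have [V nV Va] := lphi w a aphi.
by apply: filterS nV => y /Va; rewrite lte_fin valL_set_val.
Qed.

Lemma summation_D_space {R : realType} {X : metricType R} (f : X -> R[i])
    (r : R) : summation_on [set: X] f r -> D_space f.
Proof.
move=> /summation_lsc_difference[/lsc_difference_bounded_lsc[u1 [v1 [? ? E1]]]].
move=> /lsc_difference_bounded_lsc[u2 [v2 [? ? E2]]].
exists u1, v1, u2, v2; split=> // x.
by rewrite -E1 -E2; case: (f x).
Qed.

(** * Operations on representations *)

Section summation_theory.
Context {R : realType} {K : metricType R}.
Implicit Types (A B U W : set K) (f g : K -> R[i]) (r : R).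

Lemma summation_onS A B f r : A `<=` B -> summation_on B f r ->
  summation_on A f r.
Proof.
move=> AB [phi [c s l]]; exists phi; split=> [j|x /AB|x /AB]; auto.
exact: continuous_subspaceW (c j).
Qed.

Lemma eq_summation_on A f g r : {in A, f =1 g} -> summation_on A f r ->
  summation_on A g r.
Proof.
move=> fg [phi [c s l]]; exists phi; split; [exact: c|exact: s|move=> x Ax].
by rewrite -fg ?inE//; exact: l.
Qed.

Lemma summation_onD A f g r s : summation_on A f r -> summation_on A g s ->
  summation_on A (fun x => f x + g x) (r + s).
Proof.
move=> [phi [c1 s1 l1]] [psi [c2 s2 l2]].
exists (fun j x => phi j x + psi j x); split=> [j x|x Ax n|x Ax].
- by apply: cvgcD; [exact: c1|exact: c2].
- apply: le_trans (lerD (s1 x Ax n) (s2 x Ax n)); rewrite -big_split/=.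
  by apply: ler_sum => j _; exact: le_normcD.
- rewrite (_ : series _ = (fun n => series (fun j => phi j x) n +
                                     series (fun j => psi j x) n)).
    by apply: cvgcD; [exact: l1|exact: l2].
  by apply/funext => n; rewrite /series/= -big_split.
Qed.

Lemma summation_onZ A (c : R[i]) f r : summation_on A f r ->
  summation_on A (fun x => c * f x) (normc c * r).
Proof.
move=> [phi [c1 s1 l1]].
exists (fun j x => c * phi j x); split=> [j x|x Ax n|x Ax].
- by apply: cvgcM; [exact: cvg_cst|exact: c1].
- under eq_bigr do rewrite normcM.
  by rewrite -mulr_sumr ler_wpM2l ?normc_ge0// s1.
- rewrite (_ : series _ = (fun n => c * series (fun j => phi j x) n)).
    by apply: cvgcM; [exact: cvg_cst|exact: l1].
  by apply/funext => n; rewrite /series/= mulr_sumr.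
Qed.

(* A representation is the sequence of increments of its partial sums [P]. *)
Lemma summation_on_partial_sums A (P : nat -> K -> R[i]) f r :
  (forall n, {within A, continuous (P n : K -> (R[i])^o)}) ->
  (forall x, A x -> P 0%N x = 0) ->
  (forall x, A x ->
     forall n, \sum_(0 <= j < n) normc (P j.+1 x - P j x) <= r) ->
  (forall x, A x -> ((P ^~ x) : nat -> (R[i])^o) @ \oo --> (f x : (R[i])^o)) ->
  summation_on A f r.
Proof.
move=> cP P0 Pr Pf; exists (fun j x => P j.+1 x - P j x).
split=> [j x||x Ax]; [|exact: Pr|].
  by apply: cvgcB; exact: cP.
rewrite (_ : series _ = P ^~ x); first exact: Pf.
by apply/funext => n; rewrite /series/= telescope_sumr// P0// subr0.
Qed.

(** An increment of [p - q] is at most the increment of [p] plus that of [q], so the variation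
    telescopes to at most [p n + q n]. *)
Lemma summation_on_monotone A (p q : nat -> K -> R) (u v : K -> R) r :
  (forall n, {within A, continuous (p n)}) ->
  (forall n, {within A, continuous (q n)}) ->
  (forall x, A x -> 0 <= p 0%N x /\ 0 <= q 0%N x) ->
  (forall x, A x -> forall n, p n x <= p n.+1 x /\ q n x <= q n.+1 x) ->
  (forall x, A x -> forall n, p n x + q n x <= r) ->
  (forall x, A x -> (p ^~ x) @ \oo --> u x) ->
  (forall x, A x -> (q ^~ x) @ \oo --> v x) ->
  summation_on A (fun x => (u x - v x)%:C%C) r.
Proof.
move=> cp cq pq0 pqS pqr pu qv.
(* Partial sums must start at 0, so the index is shifted by one; the first increment is [p 0 - q 0],
   bounded by [p 0 + q 0]. *)
pose P n x : R := if n is m.+1 then p m x - q m x else 0.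
apply: (@summation_on_partial_sums _ (fun n x => (P n x)%:C%C)) => //.
- move=> n x; apply: cvg_real_complex; case: n => [|n]; first exact: cvg_cst.
  by apply: cvgB; [exact: cp|exact: cq].
- move=> x Ax n; under eq_bigr do rewrite -rmorphB normc_real.
  case: n => [|n].
    rewrite big_geq//; apply: le_trans (pqr x Ax 0%N).
    by have [] := pq0 x Ax; exact: addr_ge0.
  apply: le_trans (pqr x Ax n); elim: n => [|n IH].
    rewrite big_nat1/= subr0; have [? ?] := pq0 x Ax.
    by apply: le_trans (ler_normB _ _) _; rewrite !ger0_norm.
  rewrite big_nat_recr//=; apply: (le_trans (lerD IH (lexx _))).
  have [? ?] := pqS x Ax n.
  rewrite (_ : _ - _ - _ = (p n.+1 x - p n x) - (q n.+1 x - q n x)); last by ring.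
  apply: (le_trans (lerD (lexx _) (ler_normB _ _))).
  by rewrite !ger0_norm ?subr_ge0//; lra.
- move=> x Ax; apply: cvg_real_complex; rewrite -cvg_shiftS.
  by apply: cvgB; [exact: pu|exact: qv].
Qed.

End summation_theory.

(** * Lipschitz approximation and extension of real-valued functions *)

Lemma lipschitz_continuous {R : realType} {K : metricType R} (f : K -> R)
    (k : R) : 0 <= k -> (forall x y, f x <= f y + k * mdist x y) ->
  continuous f.
Proof.
move=> k0 fk x; apply/cvgrPdist_lt => e e0.
(* The radius is [e / (k + 1)], since [k] may be 0. *)
have k1 : 0 < k + 1 by rewrite ltr_wpDl.
apply/nbhs_ballP; exists (e / (k + 1)) => /=; first exact: divr_gt0.
move=> y; rewrite ballEmdist/= => xy.
have kxy : k * mdist x y < e.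
  apply: (@le_lt_trans _ _ ((k + 1) * mdist x y)).
    by rewrite ler_wpM2r ?mdist_ge0// lerDl.
  by rewrite mulrC -ltr_pdivlMr.
have := fk x y; have := fk y x; rewrite (metric_sym y x) ltr_norml; lra.
Qed.

Section inf_convolution.
Context {R : realType} {K : metricType R} (W : set K).
Hypothesis W0 : W !=set0.
Implicit Types (u : K -> R) (n : nat).

(** For [u] nonnegative on [W], the largest [n]-Lipschitz function on [K] lying below [u] on [W]
    (Pasch-Hausdorff envelope). *)
Definition inf_convolution u n x :=
  inf [set u y + n%:R * mdist x y | y in W].

(** The distance to [W]; in this form its continuity is a case of that of [inf_convolution]. *)
Definition set_dist := inf_convolution (fun=> 0) 1.

Lemma inf_convolution_le u n x y : (forall z, W z -> 0 <= u z) -> W y ->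
  inf_convolution u n x <= u y + n%:R * mdist x y.
Proof.
move=> u0 Wy; apply: ge_inf; last by exists y.
by exists 0 => _ [z Wz <-]; rewrite addr_ge0 ?u0// mulr_ge0 ?mdist_ge0.
Qed.

Lemma inf_convolution_ge u n x c :
  (forall y, W y -> c <= u y + n%:R * mdist x y) -> c <= inf_convolution u n x.
Proof.
move=> cu; apply: lb_le_inf; last by move=> _ [y Wy <-]; exact: cu.
by have [y Wy] := W0; exists (u y + n%:R * mdist x y), y.
Qed.

Lemma continuous_inf_convolution u n : (forall z, W z -> 0 <= u z) ->
  continuous (inf_convolution u n).
Proof.
move=> u0; apply: (@lipschitz_continuous _ _ _ n%:R) => // x y.
rewrite -lerBlDr; apply: inf_convolution_ge => z Wz.
rewrite lerBlDr; apply: (le_trans (inf_convolution_le n x u0 Wz)).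
rewrite -addrA lerD2l -mulrDr ler_wpM2l// addrC.
exact: metric_triangle.
Qed.

Lemma set_dist_le x y : W y -> set_dist x <= mdist x y.
Proof.
move=> Wy; have := @inf_convolution_le (fun=> 0) 1 x y (fun _ _ => lexx _) Wy.
by rewrite add0r mul1r.
Qed.

Lemma set_dist_ge x c : (forall y, W y -> c <= mdist x y) -> c <= set_dist x.
Proof.
by move=> H; apply: inf_convolution_ge => y /H; rewrite add0r mul1r.
Qed.

Lemma set_dist_ge0 x : 0 <= set_dist x.
Proof. by apply: set_dist_ge => y _; exact: mdist_ge0. Qed.

Lemma set_dist_eq0 x : W x -> set_dist x = 0.
Proof.
move=> Wx; apply/eqP; rewrite eq_le set_dist_ge0 andbT.
by rewrite -(mdistxx x) set_dist_le.
Qed.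

Lemma continuous_set_dist : continuous set_dist.
Proof. exact: continuous_inf_convolution. Qed.

(* Subtracting [n * set_dist] keeps the approximants monotone in [n], because
   [set_dist x <= mdist x y], and makes bounds on sums over [W] survive off
   [W]. *)
Definition lsc_approx u n x := inf_convolution u n x - n%:R * set_dist x.

Lemma continuous_lsc_approx u n : (forall z, W z -> 0 <= u z) ->
  continuous (lsc_approx u n).
Proof.
move=> u0 x; apply: cvgB; first exact: continuous_inf_convolution.
by apply: cvgMl_tmp; exact: continuous_set_dist.
Qed.

Lemma lsc_approx_ge0 u n x : (forall z, W z -> 0 <= u z) ->
  0 <= lsc_approx u n x.
Proof.
move=> u0; rewrite subr_ge0; apply: inf_convolution_ge => y Wy.
by rewrite ler_wpDl ?u0// ler_wpM2l// set_dist_le.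
Qed.

Lemma lsc_approxS u n x : (forall z, W z -> 0 <= u z) ->
  lsc_approx u n x <= lsc_approx u n.+1 x.
Proof.
move=> u0; rewrite lerBrDr; apply: inf_convolution_ge => y Wy.
have := inf_convolution_le n x u0 Wy; have := set_dist_le x Wy.
rewrite /lsc_approx -natr1 !mulrDl !mul1r; lra.
Qed.

(** Testing both infima at the same [y] in [W] bounds their sum by [r + 2 n d(x, y)]; the infimum
    over [y] gives [r + 2 n d(x, W)], and the two subtracted distances cancel the excess. *)
Lemma lsc_approxD_le u v n x r :
  (forall z, W z -> [/\ 0 <= u z, 0 <= v z & u z + v z <= r]) ->
  lsc_approx u n x + lsc_approx v n x <= r.
Proof.
move=> uvr; have u0 z : W z -> 0 <= u z by case/uvr.
have v0 z : W z -> 0 <= v z by case/uvr.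
(* The case [n = 0] is separate because the general one divides by [n]. *)
have [n0|n0] := posnP n.
  have [y Wy] := W0; have := inf_convolution_le n x u0 Wy.
  have := inf_convolution_le n x v0 Wy; have [_ _] := uvr y Wy.
  by rewrite /lsc_approx n0 !mul0r; lra.
have n0R : 0 < n%:R :> R by rewrite ltr0n.
have : (inf_convolution u n x + inf_convolution v n x - r) / 2 / n%:R <=
    set_dist x.
  apply: set_dist_ge => y Wy; rewrite ler_pdivrMr//.
  have := inf_convolution_le n x u0 Wy; have := inf_convolution_le n x v0 Wy.
  by have [_ _] := uvr y Wy; rewrite (mulrC (mdist x y)); lra.
by rewrite ler_pdivrMr// /lsc_approx (mulrC (set_dist x)); lra.
Qed.

(** On [W] the subtracted distance is 0. Points [y] near [x] satisfy [u y > u x - e] by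
    semicontinuity; for those at distance at least [d] the penalty [n d(x, y)] exceeds [u x] once
    [n >= u x / d]. *)
Lemma lsc_approx_cvg u x : (forall z, W z -> 0 <= u z) -> lsc_on W u -> W x ->
  lsc_approx u ^~ x @ \oo --> u x.
Proof.
move=> u0 lu Wx.
have le_u n : lsc_approx u n x <= u x.
  have := inf_convolution_le n x u0 Wx.
  by rewrite /lsc_approx mdistxx set_dist_eq0// mulr0 subr0 addr0.
apply/cvgrPdist_le => e e0.
have : u x - e < u x by rewrite ltrBlDr ltrDl.
move=> /(lu x Wx); rewrite near_withinE => /nbhs_ballP[d /= d0 dP].
near=> n; rewrite ger0_norm ?subr_ge0// lerBlDr -lerBlDl.
rewrite /lsc_approx set_dist_eq0// mulr0 subr0.
apply: inf_convolution_ge => y Wy.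
have [xyd|dxy] := ltP (mdist x y) d.
  have := dP y; rewrite ballEmdist/= => /(_ xyd Wy)/ltW/le_trans; apply.
  by rewrite lerDl mulr_ge0// mdist_ge0.
have nud : u x / d <= n%:R by near: n; exact: nbhs_infty_ger.
have : u x <= n%:R * mdist x y.
  rewrite -(divfK (lt0r_neq0 d0) (u x)).
  by apply: le_trans (ler_wpM2l _ dxy) => //; rewrite ler_wpM2r// ltW.
by have := u0 y Wy; lra.
Unshelve. all: by end_near. Qed.

(** The approximants of [u] and [v] increase and are each at most [r], the other being nonnegative,
    so they converge at every point of [K]; on [W] the limits are [u] and [v]. *)
Lemma lsc_difference_extension (g : K -> R) (r : R) :
  lsc_difference_on W g r ->
  exists h : K -> R, (forall x, W x -> h x = g x) /\
    summation_on [set: K] (fun x => (h x)%:C%C) r.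
Proof.
move=> [u [v [lu lv uv]]].
have u0 z : W z -> 0 <= u z by case/uv.
have v0 z : W z -> 0 <= v z by case/uv.
have uvr z : W z -> [/\ 0 <= u z, 0 <= v z & u z + v z <= r] by case/uv.
have nd w x : (forall z, W z -> 0 <= w z) -> nondecreasing_seq (lsc_approx w ^~ x).
  by move=> w0; apply/nondecreasing_seqP => n; exact: lsc_approxS.
have cvg_approx w x : (forall z, W z -> 0 <= w z) ->
    (forall n, lsc_approx w n x <= r) ->
    lsc_approx w ^~ x @ \oo --> limn (lsc_approx w ^~ x).
  move=> w0 wr; apply: nondecreasing_is_cvgn; first exact: nd.
  by exists r => _ [n _ <-].
exists (fun x => limn (lsc_approx u ^~ x) - limn (lsc_approx v ^~ x)); split.
  move=> x Wx; have [_ _ _ ->] := uv x Wx.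
  by rewrite (cvg_lim _ (lsc_approx_cvg u0 lu Wx))// (cvg_lim _ (lsc_approx_cvg v0 lv Wx)).
apply: (@summation_on_monotone _ _ _ (lsc_approx u) (lsc_approx v)).
- by move=> n; apply: continuous_subspaceT; exact: continuous_lsc_approx.
- by move=> n; apply: continuous_subspaceT; exact: continuous_lsc_approx.
- by move=> x _; split; exact: lsc_approx_ge0.
- by move=> x _ n; split; exact: lsc_approxS.
- by move=> x _ n; exact: lsc_approxD_le.
- move=> x _; apply: cvg_approx => // n.
  by have := lsc_approxD_le n x uvr; have := lsc_approx_ge0 n x v0; lra.
- move=> x _; apply: cvg_approx => // n.
  by have := lsc_approxD_le n x uvr; have := lsc_approx_ge0 n x u0; lra.
Qed.

End inf_convolution.

(** * Extension by zero from an open set *)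

Section cutoffs.
Context {R : realType} {K : metricType R}.
Implicit Types (A U : set K) (f : K -> R[i]) (r : R).

Lemma open_cutoffs U : open U -> exists theta : nat -> K -> R,
  [/\ forall n, continuous (theta n),
      forall n x, 0 <= theta n x <= theta n.+1 x,
      forall n x, theta n x <= 1,
      forall n x, ~ U x -> theta n x = 0
    & forall x, U x -> theta ^~ x @ \oo --> (1 : R)].
Proof.
move=> oU; have [UC0|/set0P UC0] := eqVneq (~` U) set0.
  exists (fun _ _ => 1); split=> //.
  - by move=> n x; exact: cvg_cst.
  - by move=> _ _; rewrite ler01 lexx.
  - by move=> _ x nUx; have : (~` U) x by []; rewrite UC0.
  - by move=> x _; exact: cvg_cst.
pose d := set_dist (~` U); have d0 x : 0 <= d x by exact: set_dist_ge0.
exists (fun n x => Num.min (n%:R * d x) 1); split.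
- move=> n x; apply: (@continuous_min R K (fun x => n%:R * d x) (fun=> 1)).
    by apply: cvgMl_tmp; exact: continuous_set_dist.
  exact: cvg_cst.
- move=> n x; rewrite le_min ler01 mulr_ge0//=.
  by rewrite le_min !ge_min lexx orbT andbT ler_wpM2r// ler_nat.
- by move=> n x; rewrite ge_min lexx orbT.
- by move=> n x nUx; rewrite /d set_dist_eq0// mulr0 min_l.
- move=> x Ux; have /nbhs_ballP[e /= e0 eU] := open_nbhs_nbhs (conj oU Ux).
  have dx0 : 0 < d x.
    apply: lt_le_trans e0 _; apply: set_dist_ge => // y nUy; rewrite leNgt.
    by apply/negP => xy; apply/nUy/eU; rewrite ballEmdist.
  apply/cvgrPdist_lt => c c0; near=> n.
  rewrite min_r ?subrr ?normr0// -ler_pdivrMr//.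
  by near: n; exact: nbhs_infty_ger.
Unshelve. all: by end_near. Qed.

(** The products [Q n] of [theta n] and the partial sums are the new partial sums: they are
    continuous across the boundary of [U] because [theta n] tends to 0 there while the partial sums
    stay bounded by [r]. *)
Lemma summation_on_open A U f r : open U -> summation_on (A `&` U) f r ->
  0 <= r -> summation_on A (patch (fun=> 0) U f) r.
Proof.
move=> oU [phi [c s l]] r0.
have [theta [ct t01 t1 tU0 tU1]] := open_cutoffs oU.
have t0 n x : 0 <= theta n x by have /andP[] := t01 n x.
pose P n x := series (fun j => phi j x) n.
pose T n x : R := \sum_(0 <= j < n) normc (phi j x).
have PT n x : normc (P n x) <= T n x.
  rewrite /P /T /series/=; elim: n => [|n IH]; first by rewrite !big_geq ?normc0.
  by rewrite !big_nat_recr//=; apply: (le_trans (le_normcD _ _)); rewrite lerD2r.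
pose Q n := patch (fun=> 0) U (fun x => (theta n x)%:C%C * P n x).
have QU n x : U x -> Q n x = (theta n x)%:C%C * P n x.
  by move=> Ux; rewrite /Q patchT ?inE.
have QN n x : ~ U x -> Q n x = 0.
  by move=> nUx; rewrite /Q patchN// notin_setE.
apply: (@summation_on_partial_sums _ _ _ Q).
- move=> n; apply/subspace_continuousP => x Ax.
  rewrite -[X in _ --> X]/(Q n x : (R[i])^o).
  have [Ux|nUx] := pselect (U x).
    have cQ : ((fun y => (theta n y)%:C%C * P n y) : K -> (R[i])^o) @
        within (A `&` U) (nbhs x) --> (Q n x : (R[i])^o).
      rewrite QU//; apply: cvgcM.
        apply: cvg_real_complex; apply: cvg_trans (ct n x).
        by apply: cvg_app; exact: cvg_within.
      apply: (@cvg_sum_nat _ (R[i])^o) => j.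
      by have /subspace_continuousP := c j; apply.
    move=> V /cQ; change ((\forall y \near within (A `&` U) (nbhs x),
      V ((theta n y)%:C%C * P n y)) ->
      \forall y \near within A (nbhs x), V (Q n y)).
    rewrite !near_withinE; have := open_nbhs_nbhs (conj oU Ux).
    by apply: filterS2 => y Uy VP Ay; rewrite QU//; exact: VP.
  rewrite QN//; apply/cvgcP => e e0; rewrite near_withinE.
  have : \forall y \near x, theta n y < e / (r + 1).
    apply: (cvgr_lt (theta n x)); first exact: ct.
    by rewrite tU0// divr_gt0// ltr_wpDl.
  apply: filterS => y te Ay; rewrite sub0r normcN.
  rewrite -[X in normc X]/(Q n y).
  have [Uy|nUy] := pselect (U y); last by rewrite QN// normc0.
  rewrite QU// normcM normc_real ger0_norm//.
  have r1 : 0 < r + 1 by rewrite ltr_wpDl.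
  apply: (@le_lt_trans _ _ (theta n y * (r + 1))); last by rewrite -ltr_pdivlMr.
  rewrite ler_wpM2l// (le_trans (PT n y))//.
  by rewrite (le_trans (s y _ n))// lerDl.
- move=> x Ax; have [Ux|nUx] := pselect (U x); last by rewrite QN.
  by rewrite QU// /P /series/= big_geq// mulr0.
- move=> x Ax n; have [Ux|nUx] := pselect (U x); last first.
    by rewrite big1// => j _; rewrite !QN// subrr normc0.
  (* Bounding by [theta n x * T n x], which is sharper than [r], is what makes the induction
     close. *)
  apply: (@le_trans _ _ (theta n x * T n x)); last first.
    by rewrite -[leRHS]mul1r ler_pM ?t0 ?t1 ?s// (le_trans _ (PT n x)) ?normc_ge0.
  elim: n => [|n IH].
    by rewrite big_geq// mulr_ge0// /T big_geq.
  rewrite big_nat_recr//=; apply: (le_trans (lerD IH (lexx _))).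
  rewrite !QU//.
  (* Discrete product rule; with [|P n| <= T n] the bounds add up to [theta n.+1 x * T n.+1 x]. *)
  have -> : (theta n.+1 x)%:C%C * P n.+1 x - (theta n x)%:C%C * P n x =
      (theta n.+1 x)%:C%C * phi n x +
      (theta n.+1 x - theta n x)%:C%C * P n x :> R[i].
    rewrite rmorphB/= /P /series/= big_nat_recr//=; ring.
  apply: (le_trans (lerD (lexx _) (le_normcD _ _))).
  rewrite !normcM !normc_real ger0_norm// ger0_norm; last first.
    by rewrite subr_ge0; have /andP[] := t01 n x.
  have := t01 n x => /andP[_ tS].
  have TP : (theta n.+1 x - theta n x) * normc (P n x) <=
      (theta n.+1 x - theta n x) * T n x by rewrite ler_wpM2l// subr_ge0.
  have TS : T n.+1 x = T n x + normc (phi n x) by rewrite /T big_nat_recr.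
  rewrite TS; lra.
- move=> x Ax; have [Ux|nUx] := pselect (U x); last first.
    rewrite patchN ?notin_setE//; under eq_fun do rewrite QN//; exact: cvg_cst.
  rewrite patchT ?inE//; under eq_fun do rewrite QU//.
  rewrite -[f x]mul1r; apply: cvgcM; last by apply: l.
  by apply: cvg_real_complex; exact: tU1.
Qed.

(** Absolute convergence of the real and imaginary parts; it supplies a limit at the points where
    none is prescribed. *)
Lemma normc_series_cvg (z : nat -> R[i]) r :
  (forall n, \sum_(0 <= j < n) normc (z j) <= r) ->
  exists l : R[i], (series z : nat -> (R[i])^o) @ \oo --> (l : (R[i])^o).
Proof.
move=> zr.
have part_cvg (a : nat -> R) : (forall j, `|a j| <= normc (z j)) ->
    cvgn (series a).
  move=> az; apply: normed_cvg; apply: nondecreasing_is_cvgn.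
    apply/nondecreasing_seqP => n.
    by rewrite -[leRHS]/(\sum_(0 <= j < n.+1) `|a j|) big_nat_recr//= lerDl.
  exists r => _ [n _ <-]; apply: le_trans (zr n).
  by apply: ler_sum => j _; exact: az.
have cr := part_cvg (fun j => complex.Re (z j)) (fun j => le_Re_normc (z j)).
have ci := part_cvg (fun j => complex.Im (z j)) (fun j => le_Im_normc (z j)).
exists (Complex (limn (series (fun j => complex.Re (z j))))
                (limn (series (fun j => complex.Im (z j))))).
apply/cvg_ReIm; split=> /=.
- by under eq_fun do rewrite /series/= (big_morph _ (@ReD R) (erefl _)).
- by under eq_fun do rewrite /series/= (big_morph _ (@ImD R) (erefl _)).
Qed.

End cutoffs.

(** * Extension from a closed set *)

Section closed_extension.
Context {R : realType} {K : metricType R}.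
Implicit Types (A U W : set K) (f : K -> R[i]) (r : R).

(** Tietze's theorem for the real and imaginary parts separately. No bound on [psi] is recorded, as
    the cutoffs below control the sum of the moduli. *)
Lemma complex_continuous_extension A (phi : K -> R[i]) r : closed A ->
  0 <= r -> {within A, continuous (phi : K -> (R[i])^o)} ->
  (forall x, A x -> normc (phi x) <= r) ->
  exists psi : K -> R[i], {in A, phi =1 psi} /\
    continuous (psi : K -> (R[i])^o).
Proof.
move=> cA r0 /continuous_ReIm[cr ci] phir.
have ext (h : K -> R) : {within A, continuous h} ->
    (forall x, A x -> `|h x| <= normc (phi x)) ->
    exists g : K -> R, {in A, h =1 g} /\ continuous g.
  move=> ch hphi; have r1 : 0 < r + 1 by rewrite ltr_wpDl.
  have [|g [hg cg _]] := continuous_bounded_extension pseudometric_normal cA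
    r1 ch; last by exists g.
  move=> x Ax; apply: (le_trans (hphi x Ax)); apply: (le_trans (phir x Ax)).
  by rewrite lerDl.
have [g1 [E1 c1]] := ext _ cr (fun x _ => le_Re_normc (phi x)).
have [g2 [E2 c2]] := ext _ ci (fun x _ => le_Im_normc (phi x)).
exists (fun x => Complex (g1 x) (g2 x)); split.
  by move=> x Ax; rewrite -E1// -E2// /from_subspace; case: (phi x).
by apply/(continuous_ReIm (fun x => Complex (g1 x) (g2 x))).
Qed.

Lemma summation_closed_extension A f r e : closed A -> 0 <= r -> 0 < e ->
  summation_on A f r ->
  exists g : K -> R[i], {in A, g =1 f} /\ summation_on [set: K] g (r + e).
Proof.
move=> cA r0 e0 [phi [c s l]].
have phir j x : A x -> normc (phi j x) <= r.
  move=> Ax; apply: le_trans (s x Ax j.+1); rewrite big_nat_recr//= lerDr.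
  by apply: sumr_ge0 => i _; exact: normc_ge0.
have /choice[psi psiP] := fun j =>
  complex_continuous_extension cA r0 (c j) (phir j).
have psiE j x : A x -> psi j x = phi j x.
  by move=> Ax; have [-> //] := psiP j; exact: mem_set.
have cpsi j : continuous (psi j : K -> (R[i])^o) by have [] := psiP j.
pose T n x : R := \sum_(0 <= j < n) normc (psi j x).
have T0 n x : 0 <= T n x by apply: sumr_ge0 => i _; exact: normc_ge0.
have TS n x : T n.+1 x = T n x + normc (psi n x) by rewrite /T big_nat_recr.
(* [theta n] is 1 where the first [n + 1] terms sum to at most [r], hence on
   [A], and vanishes where they sum to at least [r + e]. *)
pose theta n x : R := Num.max (Num.min ((r + e - T n.+1 x) / e) 1) 0.
have theta0 n x : 0 <= theta n x by rewrite le_max lexx orbT.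
have theta1 n x : theta n x <= 1 by rewrite ge_max ge_min lexx orbT ler01.
have thetaE n x : r + e <= T n.+1 x -> theta n x = 0.
  move=> reT; rewrite /theta max_r// ge_min pmulr_lle0 ?invr_gt0//.
  by rewrite subr_le0 reT.
have thetaA n x : A x -> theta n x = 1.
  move=> Ax; rewrite /theta min_r; first by rewrite max_l.
  rewrite ler_pdivlMr// mul1r.
  have := s x Ax n.+1; have -> : \sum_(0 <= j < n.+1) normc (phi j x) = T n.+1 x.
    by apply: eq_bigr => j _; rewrite psiE.
  by lra.
have ctheta n : continuous (theta n).
  move=> x; apply: (@continuous_max R K
    (fun x => Num.min ((r + e - T n.+1 x) / e) 1) (fun=> 0)); last exact: cvg_cst.
  apply: (@continuous_min R K
    (fun x => ((r + e - T n.+1 x) / e)) (fun=> 1)); last exact: cvg_cst.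
  apply: cvgMr_tmp; apply: cvgB; first exact: cvg_cst.
  by apply: cvg_sum_nat => j; apply: cvg_normc; exact: cpsi.
pose chi n x := (theta n x)%:C%C * psi n x.
have normc_chi n x : normc (chi n x) = theta n x * normc (psi n x).
  by rewrite normcM normc_real ger0_norm.
have chi_T n x : \sum_(0 <= j < n) normc (chi j x) <= T n x.
  apply: ler_sum => j _; rewrite normc_chi -[leRHS]mul1r ler_wpM2r//.
  exact: normc_ge0.
(* Where [T n.+1 x] is below [r + e] the factors are at most 1; elsewhere the last term vanishes and
   the induction hypothesis applies. *)
have chi_r x n : \sum_(0 <= j < n) normc (chi j x) <= r + e.
  elim: n => [|n IH]; first by rewrite big_geq// addr_ge0// ltW.
  have [/ltW Tre|reT] := ltP (T n.+1 x) (r + e).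
    exact: le_trans (chi_T n.+1 x) Tre.
  by rewrite big_nat_recr//= normc_chi thetaE// mul0r addr0.
have /choice[g gP] : forall x, exists z : R[i], (A x -> z = f x) /\
    ((series (fun j => chi j x) : nat -> (R[i])^o) @ \oo --> (z : (R[i])^o)).
  move=> x; have [Ax|nAx] := pselect (A x); last first.
    by have [z zP] := normc_series_cvg (chi_r x); exists z.
  exists (f x); split=> //; rewrite (_ : (fun j => chi j x) = (fun j => phi j x)).
    exact: l.
  by apply/funext => j; rewrite /chi thetaA// mul1r psiE.
exists g; split; first by move=> x /set_mem Ax; have [->] := gP x.
exists chi; split=> [j|x _ n|x _]; [|exact: chi_r|by have [_] := gP x].
apply: continuous_subspaceT => x; apply: cvgcM; last exact: cpsi.
by apply: cvg_real_complex; exact: ctheta.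
Qed.

End closed_extension.

(** * Extension from differences of closed sets, and comparison of norms *)

Section extensions_from_subset.
Context {R : realType} {K : metricType R} (W : set K).
Implicit Types (f : K -> R[i]) (r e : R).

Lemma bounded_lsc_difference (phi1 phi2 : W -> R) (g : K -> R) :
  bounded_lsc phi1 -> bounded_lsc phi2 ->
  (forall w : W, g (set_val w) = phi1 w - phi2 w) ->
  exists r, lsc_difference_on W g r.
Proof.
move=> /bounded_lsc_on[l1 [M1 b1]] /bounded_lsc_on[l2 [M2 b2]] gE.
(* Adding [M1 + M2] to both functions keeps the difference and makes them nonnegative, each at most
   [2 * (M1 + M2)]. *)
exists (2 * (M1 + M2) + 2 * (M1 + M2)).
exists (fun x => valL_ 0 phi1 x + (M1 + M2)),
  (fun x => valL_ 0 phi2 x + (M1 + M2)); split; [exact: lsc_onDr..|].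
move=> x Wx; set w : W := SigSub (mem_set Wx); rewrite -[x]/(set_val w).
rewrite !valL_set_val gE; have := b1 w; have := b2 w.
by rewrite !ler_norml => /andP[? ?] /andP[? ?]; split; lra.
Qed.

Lemma summation_on_DCS f r e : is_DCS W -> (forall x, ~ W x -> f x = 0) ->
  0 <= r -> 0 < e -> summation_on W f r ->
  summation_on [set: K] f (2 * (r + e)) /\
  exists g : K -> R[i], {in W, g =1 f} /\ summation_on [set: K] g (r + e).
Proof.
move=> [A1 [A2 [cA1 cA2 WA]]] fW r0 e0 fr.
(* [W] is open relative to [A1], so [f], being 0 off [W], keeps the bound [r] on [A1]. *)
have f1 : summation_on A1 f r.
  apply: (@eq_summation_on _ _ _ (patch (fun=> 0) (~` A2) f)).
    move=> x /set_mem A1x; have [A2x|nA2x] := pselect (A2 x).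
      rewrite patchN; first by rewrite fW// WA => -[].
      by rewrite notin_setE/= => /(_ A2x).
    by rewrite patchT ?inE.
  by apply: summation_on_open => //; [exact: closed_openC|rewrite -setDE -WA].
have [g [gf gr]] := summation_closed_extension cA1 r0 e0 f1.
split; last first.
  exists g; split=> // x; rewrite WA => /set_mem[A1x _].
  by apply: gf; exact: mem_set.
have re0 : 0 <= r + e by rewrite addr_ge0// ltW.
have gC : summation_on [set: K] (patch (fun=> 0) (~` A1) g) (r + e).
  by apply: summation_on_open => //; [exact: closed_openC|exact: summation_onS gr].
rewrite (_ : 2 * (r + e) = r + e + normc (-1 : R[i]) * (r + e)); last first.
  by rewrite normcN normc1; ring.
apply: eq_summation_on (summation_onD gr (summation_onZ (-1) gC)) => x _.
rewrite mulN1r; have [A1x|nA1x] := pselect (A1 x).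
  rewrite patchN; first by rewrite oppr0 addr0 gf// inE.
  by rewrite notin_setE/= => /(_ A1x).
by rewrite patchT ?inE// subrr fW// WA => -[].
Qed.

(** A representation on [K] restricts to [W] with the same bound, so no extension has smaller norm
    than the function it extends. *)
Lemma D_norm_sigL (g : K -> R[i]) : W !=set0 ->
  (D_norm (sigL W g) <= D_norm g)%E.
Proof.
move=> [x _]; have := D_norm_ge0 g x; case E : (D_norm g) => [s| |] // _.
  apply/lee_addgt0Pr => e e0; apply: D_norm_le.
  apply/summation_on_set_type/(@summation_onS _ _ _ [set: K]) => //.
  by apply: D_norm_lt; rewrite E lte_fin ltrDl.
exact: leey.
Qed.

End extensions_from_subset.

Theorem proposition1p6 (R : realType) (K : metricType R) (W : set K)
    (W_nonempty : W !=set0) (f : W -> R[i]) (fD : D_space f) :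
  [/\ exists2 g : K -> R[i], D_space g & sigL W g = f,
      real_valued f ->
        exists g : K -> R[i],
          [/\ D_space g, sigL W g = f, real_valued g & D_norm g = D_norm f],
      is_DCS W -> forall eps : R, 0 < eps ->
        exists g : K -> R[i],
          [/\ D_space g, sigL W g = f & (D_norm g <= D_norm f + eps%:E)%E]
    & (is_DCS W -> (D_norm (valL_ 0%R f) <= 2%:E * D_norm f)%E) /\
      (open W -> D_norm (valL_ 0%R f) = D_norm f)].
Proof.
pose F := valL_ 0 f.
have FE : sigL W F = f by exact: valLK.
have FW x : ~ W x -> F x = 0.
  by move=> nWx; rewrite /F/= oinv_set_val insubN ?notin_setE.
have Fr r : (D_norm f < r%:E)%E -> summation_on W F r.
  by move=> fr; apply/summation_on_set_type; rewrite FE; exact: D_norm_lt.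
have [w0 _] : exists w : W, True.
  by have [x Wx] := W_nonempty; exists (SigSub (mem_set Wx)).
have f0 := D_norm_ge0 f w0.
have ge_f g : sigL W g = f -> (D_norm f <= D_norm g)%E.
  by move=> <-; exact: D_norm_sigL.
have [phi1 [phi2 [phi3 [phi4 [b1 b2 b3 b4 fphi]]]]] := fD.
have Fphi w : F (set_val w) = f w by exact: valL_set_val.
(* These bounds come from the given semicontinuous functions and are unrelated to [D_norm f]; they
   give membership in D(K). *)
have [r1 d1] : exists r, lsc_difference_on W (fun x => complex.Re (F x)) r.
  by apply: (bounded_lsc_difference b1 b2) => w; rewrite Fphi fphi.
have [r2 d2] : exists r, lsc_difference_on W (fun x => complex.Im (F x)) r.
  by apply: (bounded_lsc_difference b3 b4) => w; rewrite Fphi fphi.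
have [h1 [h1F s1]] := lsc_difference_extension W_nonempty d1.
have [h2 [h2F s2]] := lsc_difference_extension W_nonempty d2.
have exD : exists2 g : K -> R[i], D_space g & sigL W g = f.
  exists (fun x => (h1 x)%:C%C + 'i%C * (h2 x)%:C%C).
    exact: summation_D_space (summation_onD s1 (summation_onZ 'i%C s2)).
  apply/funext => w /=; have Ww : W (set_val w) by exact: set_valP.
  by rewrite h1F// h2F// -complexE.
split=> //.
- move=> freal.
  have [r [h [hF hr hf]]] : exists r (h : K -> R),
      [/\ forall x, W x -> h x = complex.Re (F x),
          summation_on [set: K] (fun x => (h x)%:C%C) r
        & (D_norm (fun x => (h x)%:C%C) <= D_norm f)%E].
    (* For a finite norm [s], the decomposition exists with bound [s] itself, so the extension loses
       nothing. *)
    case E : (D_norm f) f0 => [s| |] // _; last first.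
      by exists r1, h1; split=> //; exact: leey.
    have ds : lsc_difference_on W (fun x => complex.Re (F x)) s.
      apply: lsc_difference_attained => e e0.
      have /Fr/summation_lsc_difference[] // : (D_norm f < (s + e)%:E)%E.
      by rewrite E lte_fin ltrDl.
    have [h [hF hs]] := lsc_difference_extension W_nonempty ds.
    by exists s, h; split=> //; exact: D_norm_le.
  have gE : sigL W (fun x => (h x)%:C%C) = f.
    apply/funext => w /=.
    by rewrite hF ?Fphi ?RRe_real//; exact: set_valP.
  exists (fun x => (h x)%:C%C); split=> //.
  + exact: summation_D_space hr.
  + by move=> x; rewrite complex_real.
  + by apply/eqP; rewrite eq_le hf ge_f.
- move=> DCS eps eps0; case E : (D_norm f) f0 => [s| |] // s0; last first.
    have [g gD gE] := exD; exists g; split=> //; exact: leey.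
  have s0R : 0 <= s by rewrite -lee_fin.
  have fs : (D_norm f < (s + eps / 2)%:E)%E.
    by rewrite E lte_fin ltrDl divr_gt0.
  (* One half of [eps] pays for the choice of a representation, the other for the extension from the
     closed set. *)
  have [||_ [g [gF gs]]] := summation_on_DCS DCS FW _ _ (Fr _ fs) (e := eps / 2).
  + by rewrite addr_ge0// divr_ge0// ltW.
  + by rewrite divr_gt0.
  exists g; split.
  + exact: summation_D_space gs.
  + rewrite -FE; apply/funext => w /=; apply: gF; apply: mem_set; exact: set_valP.
  + apply: le_trans (D_norm_le gs) _.
    by rewrite -EFinD lee_fin -addrA -splitr.
- split=> [DCS|oW].
    case E : (D_norm f) f0 => [s| |] // s0; last first.
      by rewrite gt0_muley ?leey// lte_fin.
    have s0R : 0 <= s by rewrite -lee_fin.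
    apply/lee_addgt0Pr => e e0.
    (* Two errors of [e / 4], doubled, add up to [e]. *)
    have e4 : 0 < e / 4 by rewrite divr_gt0.
    have fs : (D_norm f < (s + e / 4)%:E)%E by rewrite E lte_fin ltrDl.
    have [|Fs _] := summation_on_DCS DCS FW _ e4 (Fr _ fs).
      by rewrite addr_ge0// ltW.
    apply: le_trans (D_norm_le Fs) _.
    by rewrite -EFinM -EFinD lee_fin; lra.
  apply/eqP; rewrite eq_le ge_f// andbT.
  case E : (D_norm f) f0 => [s| |] // s0; last exact: leey.
  apply/lee_addgt0Pr => e e0; apply: D_norm_le.
  have fs : (D_norm f < (s + e)%:E)%E by rewrite E lte_fin ltrDl.
  apply: (@eq_summation_on _ _ _ (patch (fun=> 0) W F)).
    move=> x _; have [Wx|nWx] := pselect (W x); first by rewrite patchT ?inE.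
    by rewrite patchN ?notin_setE// -[RHS]/(F x) FW.
  apply: summation_on_open => //; first by rewrite setTI; exact: Fr.
  by rewrite addr_ge0// ?ltW// -lee_fin.
Qed.
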